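(* For every fixed $k\in\mathbb{N}$, $DM(n,n-k)=O(n^k)$ as $n\to\infty$.
   Context: A distance monoid is a structure $(R,\oplus,\leq,0)$ such that: $\leq$ is a total order on $R$; $r\leq r\oplus s$ for all $r,s$; if $r\leq t$ and $s\leq u$ then $r\oplus s\leq t\oplus u$; $\oplus$ is commutative and associative; and $r\oplus 0=r$ for all $r$. The Archimedean complexity $\mathrm{arch}(R)$ of a distance monoid $R$ is the least $m$ such that for all $r_0\leq r_1\leq\cdots\leq r_m$ in $R$ one has $r_0\oplus r_1\oplus\cdots\oplus r_m=r_1\oplus\cdots\oplus r_m$ (and $\omega$ if no such $m$ exists). $DM(n,k)$ denotes the number of distance monoids (up to isomorphism of ordered monoids) with exactly $n$ non-zero elements and Archimedean complexity $k$. *)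

(* Defs.v *)
From HB Require Import structures.
From mathcomp Require Import all_boot all_order all_algebra.
From mathcomp Require Import all_classical all_reals all_analysis.
Set Implicit Arguments.
Unset Strict Implicit.
Unset Printing Implicit Defensive.
Import Order.TTheory GRing.Theory Num.Theory.
Import numFieldNormedType.Exports.

Record dstruct (T : Type) := DStruct {
  dadd : T -> T -> T;
  dle : rel T;
  dzero : T
}.

Record is_distance_monoid (T : Type) (S : dstruct T) : Prop := IsDistanceMonoid {
  dle_refl : reflexive (dle S);
  dle_anti : antisymmetric (dle S);
  dle_trans : transitive (dle S);
  dle_total : total (dle S);
  dle_addr : forall r s, dle S r (dadd S r s);
  dle_add2 : forall r s t u,
    dle S r t -> dle S s u -> dle S (dadd S r s) (dadd S t u);
  daddC : commutative (dadd S);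
  daddA : associative (dadd S);
  daddr0 : right_id (dzero S) (dadd S)
}.

Definition diso (T U : Type) (A : dstruct T) (B : dstruct U) : Prop :=
  exists f : T -> U,
    [/\ bijective f,
        {morph f : x y / dadd A x y >-> dadd B x y},
        {mono f : x y / dle A x y >-> dle B x y}
      & f (dzero A) = dzero B].

Definition dsum (T : Type) (S : dstruct T) (s : seq T) : T :=
  foldr (dadd S) (dzero S) s.

(* The chain r_0 <= r_1 <= ... <= r_m is [r0 :: s] with [size s = m]; for
   [m = 0] the right-hand sum is empty, that is, zero. *)
Definition arch_le (T : Type) (S : dstruct T) (m : nat) : Prop :=
  forall (r0 : T) (s : seq T), size s = m -> sorted (dle S) (r0 :: s) ->
    dsum S (r0 :: s) = dsum S s.

(* [None] stands for omega. *)
Definition arch (T : Type) (S : dstruct T) : option nat :=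
  if pselect (exists m, `[< arch_le S m >]) is left ex_m
  then Some (ex_minn ex_m) else None.

(* The structures on a finite carrier, as a finite type, so that they can be
   counted: operation table, order table, zero. *)
Definition dcode (T : finType) : finType :=
  ({ffun T * T -> T} * {ffun T * T -> bool} * T)%type.

Definition ddecode (T : finType) (c : dcode T) : dstruct T :=
  DStruct (fun x y => c.1.1 (x, y)) (fun x y => c.1.2 (x, y)) c.2.

(* A structure with exactly n non-zero elements has n + 1 elements, hence is
   isomorphic to one carried by ['I_n.+1]; neither its order nor its zero is
   required to be the standard one of ['I_n.+1]. *)
Definition DM (n k : nat) : nat :=
  #|equivalence_partition
      (fun A B : dcode 'I_n.+1 => `[< diso (ddecode A) (ddecode B) >])
      [set A : dcode 'I_n.+1 |
        `[< is_distance_monoid (ddecode A) /\ arch (ddecode A) = Some k >]]|.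

(* Main.v *)
(** Replace every element by its rank, so that the monoid lives on [0, .., n],
and put m = n - k. A chain witnessing that the complexity is at least m, listed
downwards as r_0 >= r_1 >= ... >= r_(m-1), has strictly increasing partial sums,
hence all but k of the n non-zero ranks are partial sums. Writing G = r_0 for the
first one, G <= k + 1 and adding any g <= G raises a rank by a bounded amount. At
most k - (G - 1) ranks above G are not partial sums, and the terms r_i, which lie
between 1 and G, change at most G - 1 times; call these at most k places breaks.
Away from the breaks the partial sums are consecutive ranks with a constant step,
so the displacement caused by g is constant there. Thus the positions of the
breaks, with a bounded amount of information near each of them, determine the
monoid: there are O(n^k) choices. *)

Require Import Defs.
From HB Require Import structures.
From mathcomp Require Import all_boot all_order all_algebra.
From mathcomp Require Import all_classical all_reals all_analysis.
From mathcomp Require Import zify.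
Set Implicit Arguments.
Unset Strict Implicit.
Unset Printing Implicit Defensive.
Import Order.TTheory GRing.Theory Num.Theory.
Import numFieldNormedType.Exports.

(* MathComp-Analysis also has a [dadd], about differentials. *)
Local Notation dadd := Defs.dadd.

(** * Monoid laws on ranks and their profiles *)

Record rank_law (n : nat) (op : nat -> nat -> nat) : Prop := RankLaw {
  opC : commutative op;
  opA : associative op;
  op0 : right_id 0 op;
  op_mono : forall a b c d, a <= c -> b <= d -> op a b <= op c d;
  op_infl : forall a b, a <= op a b;
  op_closed : forall a b, a <= n -> b <= n -> op a b <= n
}.

Fixpoint psum (op : nat -> nat -> nat) (r : nat -> nat) (i : nat) : nat :=
  if i is j.+1 then op (psum op r j) (r j) else 0.

(** The at most [k + 2] chain steps of [op_disp], plus the at most [k] ranks that the chain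
    skips. *)
Definition disp (k : nat) : nat := k.*2.+2.
(** Room for the [2 (k + 1)] additions of [G] in [op_diag], each worth at most [disp k]; the last
    [k] serves arguments above [m]. *)
Definition diag_disp (k : nat) : nat := k.+1.*2 * disp k + k.

(* [p] lists the breaks. Two monoids with the same [G] and [p] can only differ
   through the values of the law near the breaks. *)
Record profile (n k : nat) (op : nat -> nat -> nat) (G : nat)
    (p : {ffun 'I_k -> 'I_n.+1}) : Prop := Profile {
  profile_G : G <= k.+1;
  profile_disp : forall u g, u <= n -> g <= G -> op u g <= u + disp k;
  profile_shift : forall u g, G < u -> u + (disp k).+1 <= n -> g <= G ->
    (forall a, p a < u \/ u + (disp k).+1 < p a) ->
    op u.+1 g = (op u g).+1;
  profile_gen : forall u, G < u -> u <= n ->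
    (exists r i, (forall j, r j <= G) /\ u = psum op r i)
    \/ exists a, p a = u :> nat;
  profile_diag : forall u v, u <= n -> v <= n ->
    op u v <= op u.-1 v.-1 + diag_disp k
}.

(** * The witnessing chain and its breaks *)

Section Chain.
Variables (n k m : nat) (op : nat -> nat -> nat) (r : nat -> nat).
Hypothesis opL : rank_law n op.
Hypothesis nE : n = m + k.
Hypothesis m_gt0 : 0 < m.
Hypothesis r_anti : forall i, r i.+1 <= r i.
Hypothesis r0_le : r 0 <= n.
Hypothesis psum_top : psum op r m.-1 <> psum op r m.

Local Notation S := (psum op r).
Local Notation G := (r 0).

Lemma op_add0 a : op 0 a = a.
Proof. by rewrite (opC opL) (op0 opL). Qed.

Lemma op_infr a b : b <= op a b.
Proof. by rewrite (opC opL); apply: op_infl opL _ _. Qed.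

Lemma r_le i j : i <= j -> r j <= r i.
Proof.
move=> /subnK <-; elim: (j - i) => // d IH.
by rewrite addSn; apply: leq_trans (r_anti _) IH.
Qed.

Lemma psum_le i j : i <= j -> S i <= S j.
Proof.
move=> /subnK <-; elim: (j - i) => // d IH.
by rewrite addSn /=; apply: leq_trans IH (op_infl opL _ _).
Qed.

Lemma psum_bound i : S i <= n.
Proof.
elim: i => //= i IH; apply: (op_closed opL) => //.
exact: leq_trans (r_le (leq0n i)) r0_le.
Qed.

(* If [r i] is absorbed by [S i], so are all later, smaller terms. *)
Lemma psum_lt i : i < m -> S i < S i.+1.
Proof.
move=> lim; rewrite ltn_neqAle psum_le // andbT; apply/eqP => Si.
have stab d : S (i + d) = S i.
  elim: d => [|d IH]; first by rewrite addn0.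
  rewrite addnS /= IH; apply/eqP; rewrite eqn_leq (op_infl opL) andbT.
  by rewrite {2}Si /=; apply: (op_mono opL) => //; apply: r_le; lia.
apply: psum_top.
have -> : m = i + (m - i) by lia.
have -> : (i + (m - i)).-1 = i + (m - i).-1 by lia.
by rewrite !stab.
Qed.

Lemma psum_gap i j : i + j <= m -> S i + j <= S (i + j).
Proof.
elim: j => [|j IH] hij; first by rewrite !addn0.
have := @psum_lt (i + j); rewrite !addnS; lia.
Qed.

Lemma psum_inj i j : i <= m -> j <= m -> S i = S j -> i = j.
Proof.
move=> hi hj e; case: (ltngtP i j) => // h; exfalso.
- have := @psum_gap i (j - i); rewrite subnKC; lia.
- have := @psum_gap j (i - j); rewrite subnKC; lia.
Qed.

Lemma psum_ge i : i <= m -> i <= S i.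
Proof. by move=> h; have := @psum_gap 0 i h. Qed.

(** The [m - i] strict increases after index [i] must still fit below [n = m + k]. *)
Lemma psum_upper i : i <= m -> S i <= i + k.
Proof.
move=> h; have := @psum_gap i (m - i); have := psum_bound m.
by rewrite subnKC //; lia.
Qed.

Lemma psum1 : S 1 = G.
Proof. by rewrite /= op_add0. Qed.

Lemma G_gt0 : 0 < G.
Proof. by rewrite -psum1; apply: psum_ge. Qed.

Lemma G_le : G <= k.+1.
Proof. by rewrite -psum1 -add1n; apply: psum_upper. Qed.

Lemma psum_shift i j : S (i + j) = op (S i) (psum op (fun l => r (i + l)) j).
Proof.
elim: j => [|j IH]; first by rewrite addn0 /= (op0 opL).
by rewrite addnS /= IH -(opA opL).
Qed.

(** A term absorbed by the earlier part of its block would be absorbed by the whole chain before it,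
    against [psum_lt]. *)
Lemma block_ge i j : i + j <= m -> j <= psum op (fun l => r (i + l)) j.
Proof.
elim: j => // j IH hij; apply: leq_ltn_trans (IH _) _; first by lia.
rewrite ltn_neqAle (op_infl opL) andbT; apply/eqP => e.
have := @psum_lt (i + j); rewrite -addnS !psum_shift -e; lia.
Qed.

(* The block of [G.+1] terms of the chain after the u-th one sums to more than
   [G], so adding [G] moves at most [G.+1] steps along the chain. *)
Lemma op_disp u g : u <= n -> g <= G -> op u g <= u + disp k.
Proof.
move=> hu hg; have GL := G_le; rewrite /disp.
case: (leqP (u + G.+1) m) => hm.
  have le1 : op u g <= S (u + G.+1).
    rewrite psum_shift; apply: (op_mono opL); first by apply: psum_ge; lia.
    by apply: leq_trans (block_ge hm); lia.
  by have := psum_upper hm; lia.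
have := op_closed opL hu (leq_trans hg r0_le); lia.
Qed.

Lemma iter_op_bound j x : x <= n ->
  iter j (op^~ G) x <= n /\ iter j (op^~ G) x <= x + j * disp k.
Proof.
move=> hx; elim: j => [|j [h1 h2]] /=; first by rewrite mul0n addn0.
split; first exact: (op_closed opL).
by have := op_disp h1 (leqnn G); rewrite mulSn; lia.
Qed.

Lemma iter_op_mono j x y : x <= y -> iter j (op^~ G) x <= iter j (op^~ G) y.
Proof. by move=> h; elim: j => //= j IH; apply: (op_mono opL). Qed.

Lemma op_iterl j x y : op (iter j (op^~ G) x) y = iter j (op^~ G) (op x y).
Proof.
elim: j => //= j <-.
by rewrite -!(opA opL) (opC opL G).
Qed.

Lemma psum_iter i j : S (i + j) <= iter j (op^~ G) (S i).
Proof.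
elim: j => [|j IH]; first by rewrite addn0.
by rewrite addnS /=; apply: (op_mono opL) => //; apply: r_le.
Qed.

(** Going back [k + 1] steps from [S u >= u] reaches [0] or, by [psum_upper], a rank at most
    [u - 1]; each step adds at most [G]. *)
Lemma le_iter_pred u : u <= m -> u <= iter k.+1 (op^~ G) u.-1.
Proof.
move=> hu; apply: leq_trans (psum_ge hu) _.
apply: (leq_trans (n := S (u - k.+1 + k.+1))); first by apply: psum_le; lia.
apply: leq_trans (psum_iter _ _) (iter_op_mono _ _).
case: (leqP k.+1 u) => h; last by have -> : u - k.+1 = 0 by lia.
have := @psum_upper (u - k.+1); lia.
Qed.

(** Below [m], [le_iter_pred] applies to both arguments and the additions of [G] move out of the
    sum. *)
Lemma op_diag u v : u <= n -> v <= n ->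
  op u v <= op u.-1 v.-1 + diag_disp k.
Proof.
move=> hu hv; rewrite /diag_disp.
have i1 := op_infl opL u.-1 v.-1; have i2 := op_infr u.-1 v.-1.
have cl := op_closed opL hu hv.
case: (leqP u m) => um; last by lia.
case: (leqP v m) => vm; last by lia.
have hn : op u.-1 v.-1 <= n by apply: (op_closed opL); lia.
have [_ b] := iter_op_bound (k.+1 + k.+1) hn.
have h : op u v <= iter (k.+1 + k.+1) (op^~ G) (op u.-1 v.-1).
  rewrite iterD [op u.-1 _](opC opL) -op_iterl (opC opL _ u.-1) -op_iterl.
  by apply: (op_mono opL); apply: le_iter_pred.
lia.
Qed.

Definition off_chain : seq nat :=
  [seq u <- iota G.+1 (n - G) | u \notin [seq S i | i <- iota 0 m.+1]].

Definition turns : seq nat :=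
  [seq S i | i <- iota 1 m.-1 & r i != r i.-1].

Definition breaks : seq nat := off_chain ++ turns.

Lemma mem_chain u : reflect (exists2 i, i <= m & u = S i)
  (u \in [seq S i | i <- iota 0 m.+1]).
Proof.
apply: (iffP mapP) => [[i]|[i h ->]]; last by exists i; rewrite // mem_iota; lia.
by rewrite mem_iota => h ->; exists i; lia.
Qed.

(** The [m - 1] distinct sums [S 2], ..., [S m] lie above [G] and off this list. *)
Lemma size_off_chain : size off_chain + m.-1 <= n - G.
Proof.
set c := [seq S i | i <- iota 2 m.-1].
have <- : size (off_chain ++ c) = size off_chain + m.-1.
  by rewrite size_cat size_map size_iota.
rewrite -[X in _ <= X](size_iota G.+1); apply: uniq_leq_size.
  rewrite cat_uniq filter_uniq ?iota_uniq //=; apply/andP; split.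
    apply/hasPn => u /mapP[i]; rewrite mem_iota => h -> .
    rewrite mem_filter negb_and negbK; apply/orP; left; apply/mem_chain.
    by exists i; lia.
  rewrite map_inj_in_uniq ?iota_uniq // => i j; rewrite !mem_iota => hi hj.
  by apply: psum_inj; lia.
move=> u; rewrite mem_cat => /orP[|]; first by rewrite mem_filter => /andP[].
case/mapP => i; rewrite !mem_iota => hi ->.
have := psum_bound i; have := @psum_gap 1 i.-1; rewrite psum1.
have -> : 1 + i.-1 = i by lia.
lia.
Qed.

(** Each turn lowers the term by at least one, starting from [G], and [r m.-1] is still positive. *)
Lemma size_turns : size turns <= G.-1.
Proof.
rewrite size_map size_filter.
have cnt j : count (fun i => r i != r i.-1) (iota 1 j) + r j <= G.
  elim: j => [|j IH]; first by rewrite add0n.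
  rewrite -[j.+1]addn1 iotaD count_cat /= add1n addn1 /= add0n.
  by have := r_anti j; case: eqP => /=; lia.
have := cnt m.-1.
suff : 0 < r m.-1 by lia.
rewrite lt0n; apply/eqP => e; apply: psum_top.
have -> : m = m.-1.+1 by lia.
by rewrite /= e (op0 opL).
Qed.

(** Here [G] cancels: [(n - G) - (m - 1) + (G - 1) = k]. *)
Lemma size_breaks : size breaks <= k.
Proof.
rewrite size_cat; have := size_off_chain; have := size_turns.
by have := G_gt0; have := G_le; lia.
Qed.

Lemma on_chain u : G < u -> u <= n -> u \notin breaks ->
  exists2 i, i <= m & u = S i.
Proof.
move=> h1 h2; rewrite mem_cat negb_or mem_filter mem_iota => /andP[h _].
by apply/mem_chain; move: h; case: (_ \in _) => //=; lia.
Qed.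

Lemma no_turn i : 0 < i -> i < m -> S i \notin breaks -> r i = r i.-1.
Proof.
move=> h1 h2; rewrite mem_cat negb_or => /andP[_ h]; apply/eqP.
apply: contraNT h => h; apply/mapP; exists i => //.
by rewrite mem_filter h mem_iota; lia.
Qed.

(* Away from the breaks the chain runs through consecutive ranks with a constant
   step, and adding that step commutes with adding [g]. *)
Lemma op_shift u g : G < u -> u + (disp k).+1 <= n -> g <= G ->
  (forall x, x \in breaks -> x < u \/ u + (disp k).+1 < x) ->
  op u.+1 g = (op u g).+1.
Proof.
move=> hG hn hg nob.
have nb t : t <= (disp k).+1 -> u + t \notin breaks.
  by move=> ht; apply/negP => /nob; lia.
have [i him ui] : exists2 i, i <= m & u = S i.
  by apply: on_chain => //; [lia | rewrite -[u]addn0 nb].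
(* The next rank is some [S l] with [l > i + t]; strict growth then squeezes [S (i + t).+1] onto
   it. *)
have run t : t <= (disp k).+1 -> i + t <= m /\ S (i + t) = u + t.
  elim: t => [|t IH] ht; first by rewrite !addn0.
  have [h1 h2] := IH (ltnW ht).
  have [l hl ul] : exists2 l, l <= m & u + t.+1 = S l.
    by apply: on_chain; [lia | lia | apply: nb].
  have lt : i + t < l.
    by rewrite ltnNge; apply/negP => /psum_le; lia.
  split; first by lia.
  have := psum_le lt; have := @psum_lt (i + t); rewrite addnS; lia.
have i_gt0 : 0 < i by case: i ui {him run} => //= ui; lia.
have rc t : t <= disp k -> r (i + t) = r i.
  elim: t => [|t IH] ht; first by rewrite addn0.
  rewrite -IH; last by lia.
  rewrite addnS -[in RHS](succnK (i + t)) -addnS; apply: no_turn; first by lia.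
    by have [] := run t.+2; lia.
  by have [_ ->] := @run t.+1 ltac:(lia); apply: nb; lia.
have step t : t <= disp k -> op (u + t) (r i) = (u + t).+1.
  move=> ht; have [_ <-] := run t ltac:(lia); rewrite -(rc t) //.
  have [_ e1] := run t ltac:(lia); have [_ e2] := run t.+1 ltac:(lia).
  by rewrite addnS in e2; rewrite -/(S (i + t).+1) e2 e1 addnS.
have dg : op u g <= u + disp k by apply: op_disp => //; lia.
have ge := op_infl opL u g.
have s0 := step 0 isT; rewrite addn0 in s0.
(* Once [u.+1] is written as [op u (r i)], the step can be added after [g]; [op u g] is still in the
   run, where this step is the successor. *)
rewrite -{1}s0 -(opA opL) [op (r i) g](opC opL) (opA opL).
have {1}-> : op u g = u + (op u g - u) by lia.
rewrite step; lia.
Qed.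

Lemma chain_profile : exists p : {ffun 'I_k -> 'I_n.+1}, profile op G p.
Proof.
have bound x : x \in breaks -> x <= n.
  rewrite mem_cat => /orP[|/mapP[i _ ->]]; last exact: psum_bound.
  by rewrite mem_filter mem_iota; lia.
(* Spare slots hold [0], which lies below every [u > G] and so never blocks [profile_shift]. *)
pose p : {ffun 'I_k -> 'I_n.+1} :=
  [ffun a : 'I_k => inord (nth 0 breaks a)].
have pP x : x \in breaks -> exists a, p a = x :> nat.
  move=> xb; have lt : index x breaks < k.
    by apply: leq_trans size_breaks; rewrite index_mem.
  by exists (Ordinal lt); rewrite ffunE nth_index // inordK // ltnS bound.
exists p; split.
- exact: G_le.
- exact: op_disp.
- move=> u g h1 h2 h3 nob; apply: op_shift => // x /pP[a <-]; exact: nob.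
- move=> u h1 h2; case: (boolP (u \in breaks)) => hb; first by right; apply: pP.
  left; have [i _ ->] := on_chain h1 h2 hb.
  by exists r, i; split => // j; apply: r_le.
- exact: op_diag.
Qed.

End Chain.

(** * Rigidity: data near the breaks determine the law *)

Definition win (k : nat) : nat := (disp k).+2.

(* The shift invariance of [profile_shift] also fails next to [0] and [n], so both
   get a window of their own. *)
Definition centre (n k : nat) (p : {ffun 'I_k -> 'I_n.+1}) (c : 'I_k + bool)
  : nat :=
  match c with inl a => p a | inr b => if b then n else 0 end.

Section Rigidity.
Variables (n k G : nat) (p : {ffun 'I_k -> 'I_n.+1}).
Variables op1 op2 : nat -> nat -> nat.
Hypotheses (L1 : rank_law n op1) (L2 : rank_law n op2).
Hypotheses (P1 : profile op1 G p) (P2 : profile op2 G p).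
Hypothesis same_win : forall c t g, t < (win k).*2 -> g <= G ->
  centre p c + t - win k <= n ->
  op1 (centre p c + t - win k) g = op2 (centre p c + t - win k) g.
Hypothesis same_diag : forall a b,
  op1 (p a).-1 (p b).-1 = op2 (p a).-1 (p b).-1 ->
  op1 (p a) (p b) = op2 (p a) (p b).

(** Inside a window the data decide; outside all windows both laws continue from [u] to [u.+1] by
    the same shift. *)
Lemma same_small u g : u <= n -> g <= G -> op1 u g = op2 u g.
Proof.
move=> hu hg; elim: u hu => [|u IH] hu.
  by rewrite (opC L1) (opC L2) (op0 L1) (op0 L2).
pose near c := (centre p c <= u.+1 + win k < centre p c + (win k).*2).
have [/existsP[c /andP[h1 h2]]|/existsPn nocov] := boolP [exists c, near c].
  have := @same_win c (u.+1 + win k - centre p c) g.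
  have -> : centre p c + (u.+1 + win k - centre p c) - win k = u.+1 by lia.
  by apply=> //; lia.
(* Avoiding the windows of [0] and [n] yields the two range conditions of [profile_shift]. *)
have n0 := nocov (inr false); have nn := nocov (inr true).
rewrite /near /= /win /disp in n0 nn; have GL := profile_G P1.
have nb a : p a < u \/ u + (disp k).+1 < p a.
  by have := nocov (inl a); rewrite /near /= /win; lia.
have [D1 D2] : G < u /\ u + (disp k).+1 <= n by rewrite /disp; lia.
rewrite (profile_shift P1 D1 D2 hg nb) (profile_shift P2 D1 D2 hg nb) IH //; lia.
Qed.

(** By associativity, the terms are added to [v] one at a time, each by [same_small]. *)
Lemma same_psum r i v : G <= n -> (forall j, r j <= G) -> v <= n ->
  psum op1 r i <= n /\ op1 (psum op1 r i) v = op2 (psum op1 r i) v.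
Proof.
move=> hG hr; elim: i v => [|i IH] v hv /=.
  by rewrite (opC L1) (opC L2) (op0 L1) (op0 L2).
have hrn : r i <= n by apply: leq_trans hG.
have [b _] := IH 0 isT; split; first exact: (op_closed L1).
have hc : op1 (r i) v <= n by apply: (op_closed L1).
rewrite -(opA L1) (proj2 (IH _ hc)) (proj2 (IH _ hrn)) -(opA L2); congr op2.
by rewrite (opC L1) (opC L2) same_small.
Qed.

(** Only pairs of breaks escape the two previous lemmas; for them [same_diag] lifts agreement from
    the pair of predecessors. *)
Lemma same_law u v : u <= n -> v <= n -> op1 u v = op2 u v.
Proof.
elim: u v => [|u IH] v hu hv.
  by rewrite (opC L1) (opC L2) (op0 L1) (op0 L2).
case: (leqP v G) => vG; first exact: same_small.
case: (leqP u.+1 G) => uG; first by rewrite (opC L1) (opC L2) same_small.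
have hG : G <= n by lia.
case: (profile_gen P1 uG hu) => [[r [i [hr ->]]]|[a ea]].
  by have [] := same_psum i hG hr hv.
case: (profile_gen P1 vG hv) => [[r [i [hr ->]]]|[b eb]].
  by rewrite (opC L1) (opC L2); have [] := same_psum i hG hr hu.
rewrite -ea -eb; apply: same_diag => //; rewrite ea eb /=; apply: IH; lia.
Qed.

End Rigidity.

(** * Transport of a distance monoid to ranks *)

Section Ranking.
Variables (n : nat) (A : dstruct 'I_n.+1).
Hypothesis HA : is_distance_monoid A.

Definition below (x : 'I_n.+1) : {set 'I_n.+1} := [set y | ~~ dle A x y].

Lemma card_below x : #|below x| < n.+1.
Proof.
rewrite -[X in _ < X]card_ord; apply: proper_card; apply/properP; split.
  exact: subset_predT.
by exists x; rewrite // inE negbK (dle_refl HA).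
Qed.

Definition rank x : 'I_n.+1 := inord #|below x|.

Lemma rank_mono x y : dle A x y = (rank x <= rank y).
Proof.
have sub a b : dle A a b -> below a \subset below b.
  move=> ab; apply/fintype.subsetP => z; rewrite !inE; apply: contra.
  exact: (dle_trans HA).
rewrite !inordK ?card_below //.
apply/idP/idP => [/sub|]; first exact: subset_leq_card.
apply: contraLR => nxy; rewrite -ltnNge; apply: proper_card.
have yx : dle A y x by have := dle_total HA x y; rewrite (negPf nxy).
apply/properP; split; first exact: sub.
by exists y; rewrite inE ?nxy // negbK (dle_refl HA).
Qed.

Lemma rank_inj : injective rank.
Proof.
by move=> x y e; apply: (dle_anti HA); rewrite !rank_mono e leqnn.
Qed.

Definition unrank : 'I_n.+1 -> 'I_n.+1 := invF rank_inj.

Lemma rankK : cancel rank unrank. Proof. exact: invF_f. Qed.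
Lemma unrankK : cancel unrank rank. Proof. exact: f_invF. Qed.

Lemma rank0 : rank (dzero A) = 0 :> nat.
Proof.
apply/eqP; rewrite -leqn0 -[0]/(nat_of_ord (@ord0 n)) -[ord0]unrankK.
rewrite -rank_mono -[unrank _](daddr0 HA) (daddC HA).
exact: (dle_addr HA).
Qed.

(* Beyond [n] the law is continued by the maximum, which makes it a monoid law
   on all of [nat]. *)
Definition rank_op (u v : nat) : nat :=
  if (u <= n) && (v <= n)
  then rank (dadd A (unrank (inord u)) (unrank (inord v))) : nat else maxn u v.

Lemma rank_opE x y : rank_op (rank x) (rank y) = rank (dadd A x y).
Proof. by rewrite /rank_op !leq_ord /= !inord_val !rankK. Qed.

Lemma rank_surj u : u <= n -> exists x, u = rank x.
Proof. by move=> h; exists (unrank (inord u)); rewrite unrankK inordK. Qed.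

Lemma rank_op_big u v : n < maxn u v -> rank_op u v = maxn u v.
Proof. by rewrite /rank_op; case: ifP => //; lia. Qed.

Lemma rank_opP (u v : nat) : (exists x y, [/\ u = rank x, v = rank y
     & rank_op u v = rank (dadd A x y)])
  \/ n < maxn u v /\ rank_op u v = maxn u v.
Proof.
case: (ltnP n (maxn u v)) => h; first by right; rewrite rank_op_big.
left; have [x ->] : exists x, u = rank x by apply: rank_surj; lia.
have [y ->] : exists x, v = rank x by apply: rank_surj; lia.
by exists x, y; rewrite rank_opE.
Qed.

Lemma rank_op_law : rank_law n rank_op.
Proof.
have cl a b : a <= n -> b <= n -> rank_op a b <= n.
  by move=> ha hb; rewrite /rank_op ha hb /= leq_ord.
split=> //.
- move=> u v; case: (rank_opP u v) => [[x [y [-> -> _]]]|[h ->]].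
    by rewrite !rank_opE (daddC HA).
  by rewrite maxnC rank_op_big // maxnC.
- move=> u v w; case: (leqP (maxn u (maxn v w)) n) => h.
    have [x ->] : exists x, u = rank x by apply: rank_surj; lia.
    have [y ->] : exists x, v = rank x by apply: rank_surj; lia.
    have [z ->] : exists x, w = rank x by apply: rank_surj; lia.
    by rewrite !rank_opE (daddA HA).
  (* Sums of ranks stay at most [n], so once an argument exceeds [n] both sides are the maximum of
     all three. *)
  have bnd a b : maxn a b <= n -> rank_op a b <= n by move=> ?; apply: cl; lia.
  case: (leqP (maxn u v) n) => huv; case: (leqP (maxn v w) n) => hvw.
  + lia.
  + rewrite (rank_op_big hvw) [RHS]rank_op_big; last by lia.
    by rewrite rank_op_big; have := bnd _ _ huv; lia.
  + rewrite (rank_op_big huv) [LHS]rank_op_big; last by lia.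
    by rewrite [RHS]rank_op_big; have := bnd _ _ hvw; lia.
  + rewrite (rank_op_big hvw) (rank_op_big huv) !rank_op_big; lia.
- move=> u; case: (leqP u n) => h; last by rewrite rank_op_big; lia.
  have [x ->] := rank_surj h.
  by rewrite -rank0 rank_opE (daddr0 HA).
- move=> a b c d; case: (rank_opP c d) => [[x [y [-> -> ->]]]|[h ->]]; last first.
    by case: (rank_opP a b) => [[x [y [ea eb ->]]]|[_ ->]]; last lia;
      move=> _ _; apply: leq_trans (ltnW h); rewrite leq_ord.
  move=> ax dy.
  have [a' ea] : exists x, a = rank x.
    by apply: rank_surj; apply: leq_trans ax _; rewrite leq_ord.
  have [b' eb] : exists x, b = rank x.
    by apply: rank_surj; apply: leq_trans dy _; rewrite leq_ord.
  move: ax dy; rewrite ea eb rank_opE -!rank_mono; exact: (dle_add2 HA).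
- move=> a b; case: (rank_opP a b) => [[x [y [-> _ ->]]]|[h ->]]; last by lia.
  by rewrite -rank_mono (dle_addr HA).
Qed.

Lemma rank_dsum s : foldr rank_op 0 [seq (rank x : nat) | x <- s]
  = rank (dsum A s).
Proof.
by elim: s => [|x s IH] /=; [rewrite rank0 | rewrite IH rank_opE].
Qed.

(** Read from its largest term down, the failing chain has [r0] last, so the two sums of [arch_le]
    become consecutive partial sums. *)
Lemma arch_chain m : ~ arch_le A m -> exists r : nat -> nat,
  [/\ forall i, r i.+1 <= r i, r 0 <= n
    & psum rank_op r m <> psum rank_op r m.+1].
Proof.
move=> /existsNP[r0 /existsNP[s /not_implyP[sz /not_implyP[srt ne]]]].
set L := [seq (rank x : nat) | x <- r0 :: s].
have Lle x : x \in L -> x <= n by case/mapP => y _ ->; rewrite leq_ord.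
have srtL : sorted geq (rev L).
  rewrite rev_sorted sorted_map; apply: sub_sorted srt => x y /=.
  by rewrite rank_mono.
have szL : size (rev L) = m.+1 by rewrite size_rev size_map /= sz.
have psumE i : i <= m.+1 ->
    psum rank_op (nth 0 (rev L)) i = foldl rank_op 0 (take i (rev L)).
  elim: i => [|i IH] hi /=; first by rewrite take0.
  by rewrite IH 1?ltnW // (take_nth 0) ?szL // foldl_rcons.
have foldE t : foldl rank_op 0 (rev t) = foldr rank_op 0 t.
  rewrite foldl_rev; elim: t => //= x t ->; exact: (opC rank_op_law).
(* The default [0] past the end keeps the sequence non-increasing. *)
exists (nth 0 (rev L)); split.
- move=> i; case: (ltnP i.+1 m.+1) => h; last first.
    by rewrite (@nth_default _ _ _ i.+1) ?szL.
  apply: (@sorted_leq_nth _ geq _ _ 0 _ srtL i i.+1) => //;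
    rewrite ?inE ?szL //; last exact: ltnW.
    by move=> a b c /= ab bc; apply: leq_trans bc ab.
  exact: leqnn.
- by apply: Lle; rewrite -mem_rev mem_nth // szL.
- rewrite !psumE // (@take_oversize _ m.+1) ?szL // foldE.
  have -> : foldr rank_op 0 L = rank (dsum A (r0 :: s)) by exact: rank_dsum.
  rewrite /L map_cons rev_cons -cats1 take_size_cat ?size_rev ?size_map ?sz //.
  rewrite foldE rank_dsum => /val_inj/rank_inj e.
  exact: ne.
Qed.

End Ranking.

(** * Codes and the count of isomorphism classes *)

Lemma diso_rank n (A B : dstruct 'I_n.+1) (HA : is_distance_monoid A)
    (HB : is_distance_monoid B) :
  (forall u v, u <= n -> v <= n -> rank_op HA u v = rank_op HB u v) -> diso A B.
Proof.
move=> e; exists (unrank HB \o rank A); split.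
- exists (unrank HA \o rank B) => x /=; first by rewrite unrankK rankK.
  by rewrite unrankK rankK.
- move=> x y /=; apply: (@rank_inj _ _ HB); apply: val_inj; rewrite /= unrankK.
  by rewrite -(rank_opE HA) -(rank_opE HB) !unrankK e ?leq_ord.
- by move=> x y /=; rewrite (rank_mono HB) !unrankK (rank_mono HA).
- by apply: (@rank_inj _ _ HB); apply: val_inj; rewrite /= unrankK !rank0.
Qed.

(** Its cardinality depends on [k] alone, so in [code] only the positions of the breaks grow with
    [n]. *)
Definition small_code (k : nat) : finType :=
  ('I_k.+2 * {ffun ('I_k + bool) * 'I_(win k).*2 * 'I_k.+2 -> 'I_(disp k).+1}
    * {ffun 'I_k * 'I_k -> 'I_(diag_disp k).+1})%type.

Definition code (n k : nat) : finType :=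
  ({ffun 'I_k -> 'I_n.+1} * small_code k)%type.

(* [op] is recorded through differences that stay bounded on a monoid of profile
   [G], [p]; [inord] truncates nothing there. *)
Definition encode (n k : nat) (op : nat -> nat -> nat) (G : nat)
    (p : {ffun 'I_k -> 'I_n.+1}) : code n k :=
  (p, (inord G,
       [ffun x : ('I_k + bool) * 'I_(win k).*2 * 'I_k.+2 =>
          let u := centre p x.1.1 + x.1.2 - win k in
          inord (op u x.2 - u)],
       [ffun x : 'I_k * 'I_k =>
          inord (op (p x.1) (p x.2) - op (p x.1).-1 (p x.2).-1)])).

Lemma inord_inj m x y : x <= m -> y <= m -> inord x = inord y :> 'I_m.+1 -> x = y.
Proof. by move=> hx hy /(congr1 val); rewrite /= !inordK. Qed.

Lemma encode_same_law n k op1 op2 G1 G2 (p1 p2 : {ffun 'I_k -> 'I_n.+1}) :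
  rank_law n op1 -> rank_law n op2 -> profile op1 G1 p1 -> profile op2 G2 p2 ->
  encode op1 G1 p1 = encode op2 G2 p2 ->
  forall u v, u <= n -> v <= n -> op1 u v = op2 u v.
Proof.
move=> L1 L2 P1 P2 e.
have ep : p2 = p1 by case: e.
subst p2; case: e => /(inord_inj (profile_G P1) (profile_G P2)) eG.
subst G2 => /ffunP eW /ffunP eE.
apply: (same_law L1 L2 P1 P2) => [c t g ht hg|a b e0].
  have hg' : g < k.+2 by rewrite ltnS; apply: leq_trans hg (profile_G P1).
  have := eW (c, Ordinal ht, Ordinal hg'); rewrite !ffunE /=.
  set u := _ - win k => e hu.
  have d1 := profile_disp P1 hu hg; have d2 := profile_disp P2 hu hg.
  have i1 := op_infl L1 u g; have i2 := op_infl L2 u g.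
  have /inord_inj := e; lia.
have := eE (a, b); rewrite !ffunE /= e0 => e.
have d1 := profile_diag P1 (leq_ord (p1 a)) (leq_ord (p1 b)).
have d2 := profile_diag P2 (leq_ord (p1 a)) (leq_ord (p1 b)).
have mono op : rank_law n op -> op (p1 a).-1 (p1 b).-1 <= op (p1 a) (p1 b).
  by move=> H; apply: (op_mono H); apply: leq_pred.
have m1 := mono _ L1; have m2 := mono _ L2.
have /inord_inj := e; lia.
Qed.

Lemma card_code n k : #|code n k| = n.+1 ^ k * #|small_code k|.
Proof. by rewrite card_prod card_ffun !card_ord. Qed.

Lemma arch_min (T : Type) (S : dstruct T) m : arch S = Some m.+1 -> ~ arch_le S m.
Proof.
rewrite /arch; case: pselect => // ex_m; case: ex_minnP => j _ min [jE] h.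
by move/asboolP: h => /min; rewrite jE ltnn.
Qed.

Lemma diso_sym (T U : Type) (A : dstruct T) (B : dstruct U) : diso A B -> diso B A.
Proof.
move=> [f [[g fK gK] fD fM f0]]; exists g; split.
- by exists f.
- by move=> x y; apply: (can_inj fK); rewrite fD !gK.
- by move=> x y; rewrite -fM !gK.
- by rewrite -f0 fK.
Qed.

Lemma diso_trans (T U V : Type) (A : dstruct T) (B : dstruct U) (C : dstruct V) :
  diso A B -> diso B C -> diso A C.
Proof.
move=> [f [bf fD fM f0]] [g [bg gD gM g0]]; exists (g \o f); split.
- exact: bij_comp.
- by move=> x y /=; rewrite fD gD.
- by move=> x y /=; rewrite gM fM.
- by rewrite /= f0 g0.
Qed.

(** On [D], [f] factors through [c]; the option type in [h] accounts for values that [c] does not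
    take there. *)
Lemma card_imset_factor (aT cT rT : finType) (f : aT -> rT) (c : aT -> cT)
    (D : {set aT}) :
  {in D &, forall x y, c x = c y -> f x = f y} -> #|f @: D| <= #|cT|.
Proof.
move=> fc; pose h z := omap f [pick x in D | c x == z].
rewrite -(card_imset _ (@Some_inj _)) -cardsT.
apply: leq_trans (leq_imset_card h _).
apply: subset_leq_card; apply/fintype.subsetP => _ /imsetP[_ /imsetP[x xD ->] ->].
apply/imsetP; exists (c x) => //; rewrite /h.
case: pickP => [y /andP[yD /eqP e]|/(_ x)].
  by rewrite /= (fc y x).
by rewrite xD eqxx.
Qed.

Lemma DM_bound n k : k < n -> DM n (n - k) <= n.+1 ^ k * #|small_code k|.
Proof.
move=> kn; rewrite -card_code /DM.
set D := [set A | _].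
pose good (A : dcode 'I_n.+1) (c : code n k) :=
  exists (HA : is_distance_monoid (ddecode A)) G p,
  profile (rank_op HA) G p /\ c = encode (rank_op HA) G p.
have /choice[c cP] (A : dcode 'I_n.+1) : exists c : code n k, A \in D -> good A c.
  case: (boolP (A \in D)) => [|_]; last first.
    by exists (encode (fun _ _ => 0) 0 [ffun => ord0]).
  rewrite inE => /asboolP[HA].
  (* By minimality the identity fails at [n - k - 1], that is, for some chain of [n - k] terms. *)
  have mE : n - k = (n - k).-1.+1 by lia.
  rewrite {1}mE => /arch_min/(arch_chain HA)[r [r_anti r0_le]].
  rewrite -mE => top.
  have nE : n = n - k + k by lia.
  have m_gt0 : 0 < n - k by lia.
  have [p pP] := chain_profile (rank_op_law HA) nE m_gt0 r_anti r0_le top.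
  by exists (encode (rank_op HA) (r 0) p) => _; exists HA, (r 0), p.
(* The partition is the image of [D] under the map from a structure to its class. *)
apply: (card_imset_factor (c := c)) => A B AD BD e.
have [HA [G1 [p1 [P1 e1]]]] := cP A AD; have [HB [G2 [p2 [P2 e2]]]] := cP B BD.
have iso : diso (ddecode A) (ddecode B).
  apply: (@diso_rank _ _ _ HA HB); apply: encode_same_law P1 P2 _.
  - exact: rank_op_law.
  - exact: rank_op_law.
  - by rewrite -e1 -e2.
apply/setP => C; rewrite !inE; congr andb; apply: asbool_equiv_eq; split.
- exact/diso_trans/diso_sym.
- exact: diso_trans.
Qed.

Local Open Scope classical_set_scope.
Local Open Scope ring_scope.

Theorem theorem1p2 (R : realType) (k : nat) :
  (fun n : nat => (DM n (n - k))%:R : R^o) =O_\oo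
  (fun n : nat => n%:R ^+ k : R^o).
Proof.
(* The factor [2 ^ k] comes from [n.+1 <= 2 * n], and the [+ 1] makes the constant positive. *)
apply/eqO_exP; exists (2 ^ k * #|small_code k| + 1)%N%:R.
  by rewrite ltr0n addn1.
near=> n.
have kn : (k < n)%N by near: n; exact: nbhs_infty_gt.
rewrite ger0_norm ?ler0n // -natrX ger0_norm ?ler0n // -natrM ler_nat.
apply: leq_trans (DM_bound kn) _.
have h : (n.+1 ^ k <= 2 ^ k * n ^ k)%N.
  rewrite -expnMn; have [->|k0] := posnP k; first by rewrite !expn0.
  by rewrite leq_exp2r //; lia.
by rewrite mulnDl mulnAC; apply: leq_trans (leq_addr _ _); rewrite leq_mul2r h orbT.
Unshelve. all: by end_near.
Qed.
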